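(* Let $\mathcal{C}$ be a finite abstract simplicial complex and $\mathcal{M}$ a matroid on the same finite ground set $V$, and let $1\le k\le r(\mathcal{M})$ and $m\ge0$ be integers. If $\eta_H(\mathcal{C}[X])+r(\mathcal{M}[V\setminus X])\ge k+m$ for all $X\subseteq V$ for which $V\setminus X$ is a flat of $\mathcal{M}$ of rank at most $k-1$, then $\eta_H(\mathbf{Int}(\mathcal{C},\mathcal{M};k))\ge m+1$.
   Context: $\mathcal{C}[X]=\{\sigma\in\mathcal{C}:\sigma\subseteq X\}$, $\mathcal{M}[X]=\{A\in\mathcal{M}:A\subseteq X\}$, $r$ is matroid rank; a flat of $\mathcal{M}$ is $F\subseteq V$ with $r(\mathcal{M}[F\cup\{x\}])>r(\mathcal{M}[F])$ for all $x\in V\setminus F$. $\eta_H(\mathcal{K})$ is $2$ plus the largest $k\ge-2$ with $\widetilde H_j(\mathcal{K};\mathbb{Q})=0$ for all $-1\le j\le k$ ($\widetilde H_{-1}=0$ meaning $\mathcal{K}$ has a vertex), possibly $\infty$. For a matroid $\mathcal{N}$ on $V$, $\mathbf{Int}(\mathcal{C},\mathcal{N})$ is the simplicial complex whose vertices are the simplices of $\mathcal{C}$ containing a basis of $\mathcal{N}$, and whose simplices are the chains $\sigma_1\subset\cdots\subset\sigma_\ell$ of such simplices. $\mathbf{Int}(\mathcal{C},\mathcal{M};k)=\mathbf{Int}(\mathcal{C},\mathcal{M}_{\le k})$, where $\mathcal{M}_{\le k}=\{A\in\mathcal{M}:|A|\le k\}$. *)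

(* Defs.v *)
From HB Require Import structures.
From mathcomp Require Import all_boot all_order all_algebra.
Set Implicit Arguments. Unset Strict Implicit. Unset Printing Implicit Defensive.
Import GRing.Theory Num.Theory.
Local Open Scope ring_scope.

Section Complex.
Variable T : finType.
Implicit Types (K : {set {set T}}) (s t : {set T}).

Definition is_complex K : bool :=
  (set0 \in K) &&
  [forall s in K, forall t : {set T}, (t \subset s) ==> (t \in K)].

Definition induced K (X : {set T}) : {set {set T}} :=
  [set s in K | s \subset X].

(* incidence sign of the face s :\ v in s, w.r.t. the fixed order of T *)
Definition bsign s (v : T) : rat :=
  (- 1) ^+ #|[set u in s | (enum_rank u < enum_rank v)%N]|.

Definition bcoef K s t : rat :=
  if (s \in K) && (t \in K) then
    \sum_(v in s) (if t == s :\ v then bsign s v else 0)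
  else 0.

Definition NS := #|{: {set T}}|.

(* The full (augmented) boundary operator of K acting on row vectors,
   indexed by all subsets of T; rows/cols outside K are zero. *)
Definition bdry K : 'M[rat]_NS :=
  \matrix_(i < NS, j < NS) bcoef K (enum_val i) (enum_val j).

(* diagonal projector onto the chain space spanned by faces of size n,
   i.e. the (n-1)-chains C_{n-1}(K; Q) (n = 0 gives C_{-1} = Q.{emptyset}) *)
Definition chains K (n : nat) : 'M[rat]_NS :=
  \matrix_(i < NS, j < NS)
    ((i == j) && (enum_val i \in K) && (#|enum_val i| == n))%:R.

(* reduced rational homology in dimension n-1 vanishes:
   every (n-1)-cycle is an (n-1)-boundary *)
Definition hvanish K (n : nat) : bool :=
  ((chains K n :&: kermx (bdry K)) <= chains K n.+1 *m bdry K)%MS.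

(* eta_H(K) as an extended natural number (None = infinity):
   eta_H = 2 + max{k >= -2 | H~_j = 0 for -1 <= j <= k}
         = least n such that H~_{n-1}(K) <> 0 (or infinity).
   Homology vanishes trivially above dimension #|T|, so the search is finite. *)
Definition eta K : option nat :=
  let n := find (fun n => ~~ hvanish K n) (iota 0 (#|T|.+2)) in
  if (n < #|T|.+2)%N then Some n else None.

End Complex.

Section Matroid.
Variable V : finType.
Implicit Types (M N : {set {set V}}) (A B X F : {set V}).

Definition is_matroid M : bool :=
  [&& set0 \in M,
      [forall A in M, forall B : {set V}, (B \subset A) ==> (B \in M)] &
      [forall A in M, forall B in M,
         (#|A| < #|B|)%N ==> [exists x in B :\: A, x |: A \in M]]].

Definition mrank M X : nat := (\max_(A in M | A \subset X) #|A|)%N.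

Definition flat M F : bool :=
  [forall x in ~: F, (mrank M F < mrank M (x |: F))%N].

Definition trunc M (k : nat) : {set {set V}} := [set A in M | (#|A| <= k)%N].

Definition is_basis N B : bool :=
  (B \in N) && [forall x, (x \notin B) ==> (x |: B \notin N)].

Definition Int (C N : {set {set V}}) : {set {set {set V}}} :=
  [set S : {set {set V}} |
     (S \subset [set s in C | [exists B, is_basis N B && (B \subset s)]]) &&
     [forall s in S, forall t in S, (s \subset t) || (t \subset s)]].

End Matroid.

(* Main.v *)
(** Let [avoid F j] be the poset of simplices [s] of [C] that are not contained
    in the flat [F] or have rank at least [j].  For [F = setT] and [j = k] its
    order complex is [Int (C, M; k)], while for [j = 0] it is a cone with apex
    the empty simplex.  Induction on [j] shows that the reduced homology of
    [avoid F j] vanishes in dimensions below [k + m + 1 - j]: one gets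
    [avoid F j.+1] from [avoid F j] by intersecting, for each flat [G] of rank
    [j] in [F] in turn, with [{s in C | s not in G}].  The union of the two
    posets is always [avoid G j], to which the induction hypothesis applies, so
    Mayer-Vietoris controls the intersection.  The homology of
    [{s in C | s not in G}] is that of [C] induced on the complement of [G]:
    both are obtained from one mapping cylinder by collapses.

    Chains are functions on finite sets, with signs given by an injective
    ranking [rk] of the vertices, so that homology can be transported along
    order-preserving injections of vertex sets. *)
Require Import Defs.
From mathcomp Require Import all_boot all_order all_algebra.
From mathcomp Require Import ring.
Set Implicit Arguments. Unset Strict Implicit. Unset Printing Implicit Defensive.
Import GRing.Theory Num.Theory.
Local Open Scope ring_scope.

(** * Chains and collapses *)

Section Chains.
Variables (T : finType) (rk : T -> nat).
Implicit Types (K : {set {set T}}) (s t : {set T}) (c d e : {set T} -> rat).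

Definition sgn t v : rat := (-1) ^+ #|[set u in t | (rk u < rk v)%N]|.

(** This is the coefficient of the boundary at [t], a sum over the cofaces of [t]. No complex
    appears in it; complexes enter only through the support condition [is_chain]. *)
Definition bd c t : rat := \sum_(v | v \notin t) sgn t v * c (v |: t).

Definition cone (a : T) c s : rat :=
  if a \in s then sgn (s :\ a) a * c (s :\ a) else 0.

(** The index [n] counts vertices, so these are chains of dimension [n - 1]. The empty face is
    allowed, which makes the homology reduced. *)
Definition is_chain K n c := forall s, c s != 0 -> s \in K /\ #|s| = n.

Definition acyclic_at K n := forall c, is_chain K n c -> bd c =1 (fun=> 0) ->
  exists2 d, is_chain K n.+1 d & bd d =1 c.

Definition down_closed K := forall s t, s \in K -> t \subset s -> t \in K.

Lemma eq_bd c d : c =1 d -> bd c =1 bd d.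
Proof. by move=> E t; apply: eq_bigr => v _; rewrite E. Qed.

Lemma bdB c d t : bd (fun s => c s - d s) t = bd c t - bd d t.
Proof.
by rewrite /bd -sumrB; apply: eq_bigr => v _; rewrite mulrBr.
Qed.

Lemma bd_neq0 c t : bd c t != 0 -> exists2 v, v \notin t & c (v |: t) != 0.
Proof.
case: (pickP [pred v | (v \notin t) && (c (v |: t) != 0)]) => [v /andP[]|no].
  by exists v.
rewrite /bd big1 ?eqxx // => v vt.
by have := no v; rewrite /= vt => /negbFE/eqP->; rewrite mulr0.
Qed.

Lemma is_chain_bd K n c : down_closed K -> is_chain K n.+1 c ->
  is_chain K n (bd c).
Proof.
move=> dK cK t /bd_neq0[v vt /cK[vtK]]; rewrite cardsU1 vt => -[<-].
by split=> //; apply: dK vtK (subsetUr _ _).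
Qed.

Lemma is_chainB K n c d : is_chain K n c -> is_chain K n d ->
  is_chain K n (fun s => c s - d s).
Proof.
move=> cK dK s; have [/eqP c0|/cK//] := boolP (c s == 0).
by rewrite c0 sub0r oppr_eq0 => /dK.
Qed.

Lemma is_chainS K K' n c : K \subset K' -> is_chain K n c -> is_chain K' n c.
Proof. by move=> sK cK s /cK[sin ?]; rewrite (subsetP sK). Qed.

Lemma sgn_sqr t v : sgn t v * sgn t v = 1.
Proof. by rewrite /sgn -expr2 sqrr_sign. Qed.

Hypothesis rk_inj : injective rk.

Lemma sgnU1 t u v : u \notin t ->
  sgn (u |: t) v = (-1) ^+ (rk u < rk v)%N * sgn t v.
Proof.
move=> ut; rewrite /sgn -exprD; congr (_ ^+ _).
have -> : [set w in u |: t | (rk w < rk v)%N] =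
    (if (rk u < rk v)%N then u |: [set w in t | (rk w < rk v)%N]
     else [set w in t | (rk w < rk v)%N]).
  apply/setP => w; case: ifP => luv; rewrite !inE.
    by case: eqP => [->|].
  by case: eqP => [->|] //=; rewrite luv andbF.
by case: ifP => // _; rewrite cardsU1 inE (negPf ut).
Qed.

Lemma sgn_swap t u v : u \notin t -> v \notin t -> u != v ->
  sgn t u * sgn (u |: t) v = - (sgn t v * sgn (v |: t) u).
Proof.
move=> ut vt neq; rewrite !sgnU1 //.
have : rk u != rk v by apply: contra neq => /eqP/rk_inj->.
by case: ltngtP => // _ _ /=; ring.
Qed.

Lemma bd_bd c t : bd (bd c) t = 0.
Proof.
pose F v w := if [&& v \notin t, w \notin t & v != w] then
  sgn t v * sgn (v |: t) w * c (w |: (v |: t)) else 0.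
have E : bd (bd c) t = \sum_v \sum_w F v w.
  rewrite /bd big_mkcond; apply: eq_bigr => v _.
  case: ifP => vt; last by rewrite big1 // => w _; rewrite /F vt.
  rewrite mulr_sumr big_mkcond; apply: eq_bigr => w _.
  rewrite /F vt !inE negb_or eq_sym /= andbC.
  by case: ifP; rewrite // mulrA.
(* Exchanging [v] and [w] changes the sign of each term by [sgn_swap], so the double sum equals its
   negative and vanishes over the rationals. *)
have : \sum_v \sum_w F v w = - \sum_v \sum_w F v w.
  rewrite [LHS]exchange_big -sumrN; apply: eq_bigr => v _.
  rewrite -sumrN; apply: eq_bigr => w _; rewrite /F.
  rewrite andbCA (eq_sym w); case: ifP => [/and3P[vt wt neq]|_]; last by rewrite oppr0.
  by rewrite sgn_swap ?(eq_sym w) // setUCA mulNr.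
by rewrite E => /eqP; rewrite -subr_eq0 opprK -mulr2n mulrn_eq0 => /eqP.
Qed.

(** The cone operator is a contracting homotopy. If [a] is not in [t], only the coface [a |: t]
    contributes; otherwise the term of [bd c (t :\ a)] at [a] cancels [c t], and the remaining terms
    match with opposite signs. *)
Lemma bd_cone a c t : bd (cone a c) t = c t - cone a (bd c) t.
Proof.
rewrite /bd {2}/cone; case: ifP => at_; last first.
  rewrite subr0 (bigD1 a) ?at_ //= big1 ?addr0 => [|v /andP[vt va]].
    by rewrite /cone setU11 setU1K ?at_ // mulrA sgn_sqr mul1r.
  by rewrite /cone !inE at_ orbF eq_sym (negPf va) mulr0.
have anot : a \notin t :\ a by rewrite !inE eqxx.
rewrite [X in _ - _ * X](bigD1 a) //= setD1K // mulrDr mulrA sgn_sqr mul1r.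
rewrite opprD addrA subrr sub0r mulr_sumr -sumrN.
apply: eq_big => [v|v vt].
  by rewrite !inE negb_and negbK; case: eqP => [->|] //=; rewrite ?at_ ?andbT.
have va : v != a by apply: contra vt => /eqP->.
have E : (v |: t) :\ a = v |: (t :\ a).
  by apply/setP => w; rewrite !inE; case: (w =P v) => // ->; rewrite va.
rewrite /cone !inE at_ orbT E !mulrA -mulNr; congr (_ * _).
have vt' : v \notin t :\ a by rewrite !inE negb_and negbK vt orbT.
rewrite -{1}(setD1K at_) !sgnU1 //.
have : rk a != rk v by apply: contra va => /eqP/rk_inj->.
by case: ltngtP => // _ _ /=; ring.
Qed.

(* Toggling [a] matches the faces of [K] outside [K1], so the relative chain
   complex is contracted by the cone operator with apex [a]. *)
Definition collapse (a : T) K K1 := [/\ down_closed K, down_closed K1, K1 \subset K &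
  forall s, s \in K -> s \notin K1 -> a |: s \in K /\ s :\ a \notin K1].

(** A relative cycle [d] is homologous to a chain of [K1]: subtract the boundary of the cone over
    its part [d'] outside [K1]. By [bd_cone], what remains outside [K1] is the cone over [bd d'],
    which vanishes there. *)
Lemma collapse_push a K K1 n d : collapse a K K1 -> is_chain K n d ->
  (forall s, s \notin K1 -> bd d s = 0) ->
  exists2 e, is_chain K n.+1 e & is_chain K1 n (fun s => d s - bd e s).
Proof.
move=> [dK dK1 sK tog] dc d0.
pose d' s := if s \in K1 then 0 else d s.
have ce : is_chain K n.+1 (cone a d').
  move=> s; rewrite /cone; case: ifP => as_; last by rewrite eqxx.
  rewrite mulf_eq0 negb_or => /andP[_]; rewrite /d'; case: ifPn => [|sK1 /dc[sinK <-]].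
    by rewrite eqxx.
  by have [] := tog _ sinK sK1; rewrite setD1K // => -> _; rewrite (cardsD1 a s) as_.
exists (cone a d') => // s ns0.
have [sinK sn] := is_chainB dc (is_chain_bd dK ce) ns0.
split=> //; apply: contraNT ns0 => sK1.
rewrite bd_cone {1}/d' (negPf sK1) opprB addrC subrK /cone.
case: ifP => // as_; have [_ sK1'] := tog _ sinK sK1.
suff -> : bd d' (s :\ a) = 0 by rewrite mulr0.
have -> : bd d' (s :\ a) = bd d (s :\ a) - bd (fun u => if u \in K1 then d u else 0) (s :\ a).
  rewrite -bdB; apply: eq_bd => u; rewrite /d'.
  by case: ifP => _; rewrite ?subrr ?subr0.
rewrite d0 // sub0r; apply/eqP; rewrite oppr_eq0; apply: contraNT sK1'.
move=> /bd_neq0[v _]; case: ifP => [vK1 _|]; last by rewrite eqxx.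
exact: dK1 vK1 (subsetUr _ _).
Qed.

(** Downwards, a chain of [K] bounding a cycle of [K1] is itself a relative cycle and can be pushed
    into [K1]. Upwards, the cycle is pushed into [K1] and bounded there, and the correction is added
    back. *)
Lemma collapse_acyclic a K K1 n : collapse a K K1 ->
  acyclic_at K n <-> acyclic_at K1 n.
Proof.
move=> col; have [dK dK1 sK tog] := col; split=> ac c cc c0.
  have [d dd dE] := ac _ (is_chainS sK cc) c0.
  have [|e ee eK1] := collapse_push col dd.
    by move=> s sK1; rewrite dE; apply/eqP; apply: contraNT sK1 => /cc[].
  by exists (fun s => d s - bd e s) => // s; rewrite bdB bd_bd subr0 dE.
have [|e ee eK1] := collapse_push col cc; first by move=> s _; rewrite c0.
have [|d dd dE] := ac _ eK1; first by move=> s; rewrite bdB bd_bd c0 subr0.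
exists (fun s => d s - (- e s)) => [|s].
  apply: is_chainB (is_chainS sK dd) _ => s; rewrite oppr_eq0; exact: ee.
rewrite bdB dE.
have -> : bd (fun s => - e s) s = - bd e s.
  by rewrite /bd -sumrN; apply: eq_bigr => v _; rewrite mulrN.
by rewrite opprK subrK.
Qed.

Lemma cone_acyclic a K n : down_closed K ->
  (forall s, s \in K -> a |: s \in K) -> acyclic_at K n.
Proof.
move=> dK aK; apply/(@collapse_acyclic a K set0).
  split=> // [s t||s sK _]; rewrite ?inE ?sub0set //.
  by split; [exact: aK|].
move=> c cc _; have c0 s : c s = 0.
  by apply/eqP; apply/negPn/negP => /cc[]; rewrite inE.
exists c => [s|s]; first by rewrite c0 eqxx.
by rewrite c0 /bd big1 // => v _; rewrite c0 mulr0.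
Qed.

(** If [c] bounds [d1] in [K1] and [d2] in [K2], then [d1 - d2] is a cycle of the union, hence some
    [bd e]. Splitting [e = e1 + e2] between the two complexes, [d1 - bd e1 = d2 + bd e2] lies in
    both and still bounds [c]. *)
Lemma mayer_vietoris K1 K2 n : down_closed K1 -> down_closed K2 ->
  acyclic_at K1 n -> acyclic_at K2 n -> acyclic_at (K1 :|: K2) n.+1 ->
  acyclic_at (K1 :&: K2) n.
Proof.
move=> dK1 dK2 ac1 ac2 acU c cc c0.
have [d1 c1 E1] := ac1 _ (is_chainS (subsetIl _ _) cc) c0.
have [d2 c2 E2] := ac2 _ (is_chainS (subsetIr _ _) cc) c0.
have [|s|e ce eE] := acU (fun s => d1 s - d2 s).
- apply: is_chainB; [exact: is_chainS (subsetUl _ _) c1|exact: is_chainS (subsetUr _ _) c2].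
- by rewrite bdB E1 E2 subrr.
pose e1 s := if s \in K1 then e s else 0.
pose e2 s := e s - e1 s.
have ce1 : is_chain K1 n.+2 e1.
  by move=> s; rewrite /e1; case: ifP => [sK1 /ce[]//|]; rewrite eqxx.
have ce2 : is_chain K2 n.+2 (fun s => - e2 s).
  move=> s; rewrite oppr_eq0 /e2 /e1; case: ifP => sK1; first by rewrite subrr eqxx.
  by rewrite subr0 => /ce[]; rewrite inE sK1.
exists (fun s => d1 s - bd e1 s) => [|s]; last by rewrite bdB bd_bd subr0 E1.
move=> s s0; have [s1 ss] := is_chainB c1 (is_chain_bd dK1 ce1) s0.
split=> //; rewrite inE s1 /=.
suff E : d1 s - bd e1 s = d2 s - bd (fun s => - e2 s) s.
  by move: s0; rewrite E => /(is_chainB c2 (is_chain_bd dK2 ce2))[].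
have -> : d1 s = d2 s + bd e s by rewrite eE addrC subrK.
have -> : bd (fun s => - e2 s) s = bd e1 s - bd e s.
  by rewrite -bdB; apply: eq_bd => t; rewrite /e2 opprB.
ring.
Qed.
End Chains.

(** * Transport of homology along injections of vertex sets *)

Lemma imset_setU1 (T T' : finType) (f : T -> T') v (t : {set T}) :
  f @: (v |: t) = f v |: (f @: t).
Proof. by rewrite imsetU imset_set1. Qed.

Section Transport.
Variables (T T' : finType) (rk : T -> nat) (rk' : T' -> nat) (f : T -> T').
Hypothesis f_inj : injective f.
Hypothesis rk_f : forall u v, (rk' (f u) < rk' (f v))%N = (rk u < rk v)%N.
Implicit Types (s : {set T}).
Variable K : {set {set T}}.
Let fK : {set {set T'}} := [set f @: (s : {set T}) | s : {set T} in K].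

Lemma mem_fK s : (f @: s \in fK) = (s \in K).
Proof. by apply: mem_imset; exact: imset_inj. Qed.

Lemma preimset_imset s : f @^-1: (f @: s) = s.
Proof. by apply/setP => x; rewrite inE mem_imset. Qed.

Lemma sgn_transport s v : sgn rk' (f @: s) (f v) = sgn rk s v.
Proof.
rewrite /sgn; congr (_ ^+ _); rewrite -(card_imset _ f_inj); apply: eq_card => w.
rewrite inE; apply/andP/imsetP => [[/imsetP[u us ->]]|[u]].
  by rewrite rk_f => l; exists u; rewrite ?inE ?us.
by rewrite inE => /andP[us l] ->; rewrite rk_f imset_f.
Qed.

Lemma bd_transport n c (t : {set T}) : is_chain fK n c ->
  bd rk' c (f @: t) = bd rk (fun s => c (f @: s)) t.
Proof.
move=> cc; rewrite /bd (bigID (fun w => w \in f @: setT)) /= [X in _ + X]big1 ?addr0.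
  transitivity (\sum_(w in f @: [set v | v \notin t]) sgn rk' (f @: t) w * c (w |: (f @: t))).
    apply: eq_bigl => w; apply/andP/imsetP => [[wt /imsetP[v _ E]]|[v]].
      by exists v => //; move: wt; rewrite E mem_imset // inE.
    by rewrite inE => vt ->; rewrite mem_imset // imset_f.
  rewrite big_imset /=; last by move=> x y _ _; exact: f_inj.
  by apply: eq_big => [v|v _]; rewrite ?inE // sgn_transport imset_setU1.
(* A vertex outside the image of [f] belongs to no face of [fK], so its term is zero. *)
move=> w /andP[_ wf]; suff -> : c (w |: (f @: t)) = 0 by rewrite mulr0.
apply/eqP; apply: contraNT wf => /cc[/imsetP[s _ E] _].
have /imsetP[v _ ->] : w \in f @: s by rewrite -E setU11.
exact: imset_f.
Qed.

Lemma bd_off_image n c (t : {set T'}) : is_chain fK n c -> down_closed K ->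
  (forall s, t != f @: s) -> bd rk' c t = 0.
Proof.
move=> cc dK tN; apply/eqP/negPn/negP => /bd_neq0[v vt /cc[/imsetP[s _ E] _]].
suff /eqP : t = f @: (f @^-1: t) by apply/negP.
apply/setP => w; apply/idP/imsetP => [wt|[u]]; last by rewrite inE => ut ->.
have /imsetP[u _ Eu] : w \in f @: s by rewrite -E inE wt orbT.
by exists u; rewrite // inE -Eu.
Qed.

(** Extension by zero; on [fK] the preimage under [f] inverts the direct image. *)
Let ext (c : {set T} -> rat) (s : {set T'}) := if s \in fK then c (f @^-1: s) else 0.

Lemma extE n c : is_chain K n c -> (fun s => ext c (f @: s)) =1 c.
Proof.
move=> cc s; rewrite /ext mem_fK preimset_imset; case: ifPn => // sK.
by apply/esym/eqP; apply: contraNT sK => /cc[].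
Qed.

Lemma is_chain_ext n c : is_chain K n c -> is_chain fK n (ext c).
Proof.
move=> cc s; rewrite /ext; case: ifP; last by rewrite eqxx.
move=> /imsetP[u uK ->]; rewrite preimset_imset => /cc[_ <-].
by rewrite card_imset // imset_f.
Qed.

Lemma is_chain_res n c : is_chain fK n c -> is_chain K n (fun s => c (f @: s)).
Proof. by move=> cc s /cc[]; rewrite mem_fK card_imset. Qed.

Lemma image_cases (t : {set T'}) : (exists s, t = f @: s) \/ forall s : {set T}, t != f @: s.
Proof.
case: (pickP [pred s : {set T} | t == f @: s]) => [s /eqP|no]; first by left; exists s.
by right=> s; have /= -> := no s.
Qed.

Lemma acyclic_transport n : down_closed K ->
  acyclic_at rk K n <-> acyclic_at rk' fK n.
Proof.
move=> dK; split=> ac c cc c0.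
  have [|d dd dE] := ac _ (is_chain_res cc).
    by move=> s; rewrite -(bd_transport _ cc) c0.
  exists (ext d); first exact: is_chain_ext.
  move=> t; have [[s ->]|tN] := image_cases t.
    rewrite (bd_transport _ (is_chain_ext dd)).
    by rewrite (eq_bd _ (extE dd)) dE.
  rewrite (bd_off_image (is_chain_ext dd)) //; apply/esym/eqP/negPn/negP.
  by move=> /cc[/imsetP[s _ E]]; have := tN s; rewrite E eqxx.
have [t|d dd dE] := ac _ (is_chain_ext cc).
  have [[s ->]|tN] := image_cases t; last exact: bd_off_image (is_chain_ext cc) dK tN.
  by rewrite (bd_transport _ (is_chain_ext cc)) (eq_bd _ (extE cc)) c0.
exists (fun s => d (f @: s)); first exact: is_chain_res.
by move=> s; rewrite -(bd_transport _ dd) dE (extE cc).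
Qed.
End Transport.

(** * Comparison with the matrix definition of homology *)

Section Bridge.
Variable T : finType.
Implicit Types (K : {set {set T}}).
Let rk (v : T) : nat := enum_rank v.

Lemma rk_enum_inj : injective rk.
Proof. by move=> u v /val_inj/enum_rank_inj. Qed.

Lemma bsign_sgn (t : {set T}) v : bsign (v |: t) v = sgn rk t v.
Proof.
rewrite /bsign /sgn; congr (_ ^+ _); apply: eq_card => u; rewrite !inE.
by case: eqP => [->|//]; rewrite ltnn !andbF.
Qed.

Definition row_chain (c : {set T} -> rat) : 'rV[rat]_(NS T) := \row_i c (enum_val i).

Lemma row_chain_bd K n c : down_closed K -> is_chain K n c ->
  row_chain c *m bdry K = row_chain (bd rk c).
Proof.
move=> dK cc; apply/rowP => j; rewrite !mxE.
under eq_bigr => i _ do rewrite !mxE.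
rewrite (reindex _ (onW_bij _ (@enum_rank_bij _))) /=.
under eq_bigr => s _ do rewrite enum_rankK.
move: (enum_val j) => t.
have cN s : s \notin K -> c s = 0 by move=> sK; apply/eqP; apply: contraNT sK => /cc[].
have [tK|tK] := boolP (t \in K); last first.
  rewrite big1 => [|s _]; last by rewrite /bcoef (negPf tK) andbF mulr0.
  rewrite /bd big1 // => v _; rewrite cN ?mulr0 //.
  by apply: contra tK => /dK; apply; apply: subsetUr.
(* Both sides become sums over pairs of a face [s] and a vertex [v] with [s = v |: t]. The matrix
   sums over [s] first, [bd] over [v] first. *)
transitivity (\sum_(s : {set T}) \sum_v
    if (v \in s) && (t == s :\ v) then sgn rk t v * c (v |: t) else 0).
  apply: eq_bigr => s _; rewrite /bcoef tK andbT; case: ifPn => [sK|sK]; last first.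
    rewrite mulr0 big1 // => v _; case: ifP => // /andP[vs /eqP->].
    by rewrite setD1K // cN // mulr0.
  rewrite mulr_sumr big_mkcond; apply: eq_bigr => v _.
  case: ifP => //= vs; case: eqP => [->|_]; last by rewrite mulr0.
  by rewrite setD1K // mulrC -bsign_sgn setD1K.
rewrite exchange_big /bd [RHS]big_mkcond; apply: eq_bigr => v _.
case: ifPn => vt.
  rewrite (bigD1 (v |: t)) //= setU11 setU1K // eqxx big1 ?addr0 // => s sN.
  case: ifP => // /andP[vs /eqP E]; by rewrite E setD1K ?eqxx in sN.
by rewrite big1 // => s _; case: ifP => // /andP[vs /eqP E]; rewrite E !inE eqxx in vt.
Qed.

Lemma row_chainP K n c : reflect (is_chain K n c) (row_chain c <= chains K n)%MS.
Proof.
apply: (iffP submxP) => [[D E] s|cc].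
  have := congr1 (fun M : 'rV_(NS T) => M 0 (enum_rank s)) E.
  rewrite !mxE enum_rankK => ->.
  rewrite (bigD1 (enum_rank s)) //= big1 => [|i iN].
    rewrite !mxE eqxx enum_rankK addr0.
    rewrite mulf_eq0 negb_or => /andP[_].
    by case: (s \in K); case: (#|s| =P n); rewrite //= eqxx.
  by rewrite !mxE (negPf iN) mulr0.
exists (row_chain c); apply/rowP => j; rewrite !mxE (bigD1 j) //= big1 ?addr0 => [|i iN].
  rewrite !mxE eqxx /=; have [->|/cc[-> ->]] := eqVneq (c (enum_val j)) 0.
    by rewrite mul0r.
  by rewrite eqxx mulr1.
by rewrite !mxE (negPf iN) mulr0.
Qed.

Lemma row_chain_surj (x : 'rV[rat]_(NS T)) : x = row_chain (fun s => x 0 (enum_rank s)).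
Proof. by apply/rowP => i; rewrite mxE enum_valK. Qed.

Lemma row_chain_eq c d : row_chain c = row_chain d <-> c =1 d.
Proof.
split=> [E s|E]; last by apply/rowP => i; rewrite !mxE E.
have := congr1 (fun M : 'rV_(NS T) => M 0 (enum_rank s)) E.
by rewrite !mxE enum_rankK.
Qed.

Lemma row_chain0 c : row_chain c = 0 <-> c =1 (fun=> 0).
Proof.
rewrite -(row_chain_eq c); have -> // : row_chain (fun=> 0) = 0.
by apply/rowP => i; rewrite !mxE.
Qed.

Lemma hvanishP K n : down_closed K -> hvanish K n <-> acyclic_at rk K n.
Proof.
move=> dK; split=> [/rV_subP H c cc c0|ac].
  have /submxP[D E] : (row_chain c <= chains K n.+1 *m bdry K)%MS.
    apply: H; rewrite sub_capmx; apply/andP; split; first exact/row_chainP.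
    apply/sub_kermxP; rewrite (row_chain_bd dK cc); exact/row_chain0.
  rewrite mulmxA in E; have dd := submxMl D (chains K n.+1).
  rewrite [D *m _]row_chain_surj in E dd; move/row_chainP: dd => dd.
  exists (fun s => (D *m chains K n.+1) 0 (enum_rank s)) => //.
  by apply/row_chain_eq; rewrite E (row_chain_bd dK dd).
apply/rV_subP => x; rewrite [x]row_chain_surj sub_capmx => /andP[/row_chainP cc /sub_kermxP].
rewrite (row_chain_bd dK cc) => /row_chain0 c0.
have [d /row_chainP dd /row_chain_eq <-] := ac _ cc c0.
by rewrite -(row_chain_bd dK (elimT (row_chainP _ _ _) dd)) submxMr.
Qed.

Lemma hvanish_large K n : down_closed K -> (#|T| < n)%N -> hvanish K n.
Proof.
move=> dK nT; apply/hvanishP => // c cc _; exists c => s; last first.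
  suff c0 u : c u = 0 by rewrite c0 /bd big1 // => v _; rewrite c0 mulr0.
  apply/eqP/negPn/negP => /cc[_ un]; by have := max_card (mem u); rewrite un leqNgt nT.
by move=> /cc[_ sn]; have := max_card (mem s); rewrite sn leqNgt nT.
Qed.

(** The search in [eta] stops at the first degree with nonzero homology. Degrees beyond its range
    exceed [#|T|], where all chains vanish, so a failed search means vanishing everywhere. *)
Lemma eta_geP K p : down_closed K ->
  is_true (if eta K is Some a then p <= a else true)%N <->
  forall n, (n < p)%N -> acyclic_at rk K n.
Proof.
move=> dK; rewrite /eta; set q := find _ _.
have below n : (n < q)%N -> hvanish K n.
  move=> nq; have [nT|nT] := ltnP n #|T|.+2; last first.
    by apply: hvanish_large => //; apply: leq_trans nT.
  by have /negbFE := before_find 0%N nq; rewrite nth_iota.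
have sz : size (iota 0 #|T|.+2) = #|T|.+2 by rewrite size_iota.
case: ifP => qT; last first.
  split=> // _ n _; apply/hvanishP => //.
  have [nq|qn] := ltnP n q; first exact: below.
  apply: hvanish_large => //; apply: leq_trans qn.
  by apply: ltnW; rewrite leqNgt qT.
split=> [pq n np|H]; first by apply/hvanishP => //; apply: below; apply: leq_trans pq.
rewrite leqNgt; apply/negP => /H/hvanishP-/(_ dK).
have : has (fun n => ~~ hvanish K n) (iota 0 #|T|.+2) by rewrite has_find sz.
by move=> /(nth_find 0%N); rewrite nth_iota // add0n => /negP.
Qed.
End Bridge.

(** * Order complexes *)

Section OrderComplex.
Variable V : finType.
Implicit Types (A C U W : {set {set V}}) (S : {set {set V}}) (s t a b G : {set V}).

Definition chainb S := [forall s in S, forall t in S, (s \subset t) || (t \subset s)].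

Definition order_complex U : {set {set {set V}}} :=
  [set S : {set {set V}} | (S \subset U) && chainb S].

Lemma chainP S :
  reflect {in S &, forall s t, (s \subset t) || (t \subset s)} (chainb S).
Proof.
apply: (iffP forall_inP) => [H s t sS tS|H s sS]; first by have /forall_inP := H s sS; apply.
by apply/forall_inP => t; apply: H.
Qed.

Lemma order_complexE U S : (S \in order_complex U) = (S \subset U) && chainb S.
Proof. by rewrite inE. Qed.

Lemma chainS S S' : S' \subset S -> chainb S -> chainb S'.
Proof. by move=> /subsetP sS /chainP H; apply/chainP => s t /sS ? /sS; apply: H. Qed.

Lemma order_complex_down U : down_closed (order_complex U).
Proof.
move=> S S'; rewrite !order_complexE => /andP[SU cS] sS.
by rewrite (subset_trans sS SU) (chainS sS cS).
Qed.

Lemma order_complexI U W : order_complex U :&: order_complex W = order_complex (U :&: W).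
Proof.
by apply/setP => S; rewrite inE !order_complexE subsetI andbACA andbb.
Qed.

Definition up_closed C U :=
  U \subset C /\ forall s t, s \in U -> s \subset t -> t \in C -> t \in U.

(** A chain not inside [U] has a member [s] outside [U], hence in [W]. Members above [s] are in [W]
    by up-closure, and those below [s] are too, since one in [U] would force [s] into [U]. *)
Lemma order_complexU C U W : up_closed C U -> up_closed C W ->
  order_complex U :|: order_complex W = order_complex (U :|: W).
Proof.
move=> [UC upU] [WC upW]; apply/setP => S; rewrite inE !order_complexE -andb_orl.
have [cS|_] := boolP (chainb S); rewrite ?andbF // !andbT.
apply/orP/idP => [[sS|sS]|/subsetP sS].
- exact: subset_trans sS (subsetUl _ _).
- exact: subset_trans sS (subsetUr _ _).
have [SU|/subsetPn[s sinS sU]] := boolP (S \subset U); first by left.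
right; apply/subsetP => t tS.
have sW : s \in W by have := sS s sinS; rewrite inE (negPf sU).
have tUW := sS t tS.
have tC : t \in C by move: tUW; rewrite inE => /orP[/(subsetP UC)|/(subsetP WC)].
have /orP[st|ts] := chainP _ cS s t sinS tS; first exact: upW sW st tC.
move: tUW; rewrite inE => /orP[tU|//].
by rewrite (upU t s) // (subsetP WC) in sU.
Qed.

(** * The mapping cylinder and its two collapses *)

Local Notation VP := (V + {set V})%type.

(** All of [V] is ranked before all of [{set V}], so both injections preserve order, as transport
    requires. *)
Definition rk_sum (x : VP) : nat :=
  match x with
  | inl v => enum_rank v
  | inr s => #|V| + enum_rank s
  end.

Lemma rk_sum_inj : injective rk_sum.
Proof.
move=> [u|s] [v|t] /= E.
- by congr inl; apply/enum_rank_inj/val_inj.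
- by have := ltn_ord (enum_rank u); rewrite E ltnNge leq_addr.
- by have := ltn_ord (enum_rank v); rewrite -E ltnNge leq_addr.
by congr inr; apply/enum_rank_inj/val_inj/(@addnI #|V|).
Qed.

(* Simplicial mapping cylinder between the complex [A] and the order complex of
   [W]: a face joins a simplex [a] of [A] to a chain of [W] lying above [a]. *)
Definition cylinder A W : {set {set VP}} :=
  [set B : {set VP} | [&& inl @^-1: B \in A, inr @^-1: B \in order_complex W &
     [forall s in inr @^-1: B, inl @^-1: B \subset s]]].

Lemma cylinderP A W (B : {set VP}) :
  reflect [/\ inl @^-1: B \in A, inr @^-1: B \in order_complex W &
             forall s, s \in inr @^-1: B -> inl @^-1: B \subset s] (B \in cylinder A W).
Proof. by rewrite [X in reflect _ X]in_set; apply: (iffP and3P) => -[? ? /forall_inP]. Qed.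

Lemma cylinder_down A W : down_closed A -> down_closed (cylinder A W).
Proof.
move=> dA B B' /cylinderP[BA BW BS] sB; apply/cylinderP; split.
- exact: dA BA (preimsetS _ sB).
- exact: order_complex_down BW (preimsetS _ sB).
move=> s sB'; apply: subset_trans (preimsetS _ sB) (BS _ _).
by move: sB'; rewrite !inE; apply: (subsetP sB).
Qed.

Lemma cylinderS A A' W W' : A \subset A' -> W \subset W' ->
  cylinder A W \subset cylinder A' W'.
Proof.
move=> sA sW; apply/subsetP => B /cylinderP[BA BW BS]; apply/cylinderP; split=> //.
  exact: (subsetP sA).
by move: BW; rewrite !order_complexE => /andP[BW ->]; rewrite (subset_trans BW).
Qed.

Lemma inl_addl v (B : {set VP}) : inl @^-1: (inl v |: B) = v |: inl @^-1: B.
Proof. by apply/setP => x; rewrite !inE. Qed.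
Lemma inr_addl v (B : {set VP}) : inr @^-1: (inl v |: B) = inr @^-1: B.
Proof. by apply/setP => x; rewrite !inE. Qed.
Lemma inr_dell v (B : {set VP}) : inr @^-1: (B :\ inl v) = inr @^-1: B.
Proof. by apply/setP => x; rewrite !inE. Qed.
Lemma inl_addr s (B : {set VP}) : inl @^-1: (inr s |: B) = inl @^-1: B.
Proof. by apply/setP => x; rewrite !inE. Qed.
Lemma inr_addr s (B : {set VP}) : inr @^-1: (inr s |: B) = s |: inr @^-1: B.
Proof. by apply/setP => x; rewrite !inE. Qed.
Lemma inl_delr s (B : {set VP}) : inl @^-1: (B :\ inr s) = inl @^-1: B.
Proof. by apply/setP => x; rewrite !inE. Qed.

(** A face using [s] has [s] at the bottom of its chain, because [s] has least size in [W]. Its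
    simplex part need only lie in [s], so [v] can be toggled freely. *)
Lemma collapse_poset_vertex A W s v : down_closed A -> s \in W ->
  (forall t, t \in W -> #|s| <= #|t|)%N -> v \in s ->
  (forall a, a \in A -> a \subset s -> v |: a \in A) ->
  collapse (inl v) (cylinder A W) (cylinder A (W :\ s)).
Proof.
move=> dA sW smin vs vA; split; try exact: cylinder_down.
  by apply: cylinderS => //; apply: subsetDl.
move=> B /cylinderP[BA BW BS] BN.
have sB : s \in inr @^-1: B.
  apply: contraNT BN => sB; apply/cylinderP; split=> //.
  move: BW; rewrite !order_complexE subsetD1 => /andP[-> ->].
  by rewrite sB.
have /andP[/subsetP BsubW /chainP Bch] : (inr @^-1: B \subset W) && chainb (inr @^-1: B).
  by rewrite -order_complexE.
have sle t : t \in inr @^-1: B -> s \subset t.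
  move=> tB; have /orP[//|ts] := Bch s t sB tB.
  by have /eqP-> : t == s by rewrite eqEcard ts smin // BsubW.
split.
  apply/cylinderP; rewrite inl_addl inr_addl; split=> //; first exact: vA (BS _ sB).
  by move=> t tB; rewrite subUset sub1set (subsetP (sle t tB)) //= BS.
apply/negP => /cylinderP[_]; rewrite inr_dell order_complexE subsetD1 sB.
by rewrite andbF.
Qed.

(** The part of [A] inside each [s] of [W] is a cone, so the elements of [W] can be removed one by
    one, smallest first, until only [A] is left. *)
Lemma cylinder_bottom A W n : down_closed A ->
  (forall s, s \in W -> exists2 v, v \in s &
     forall a, a \in A -> a \subset s -> v |: a \in A) ->
  acyclic_at rk_sum (cylinder A W) n <-> acyclic_at rk_sum (cylinder A set0) n.
Proof.
move=> dA; have [N] := ubnP #|W|; elim: N W => // N IH W cW HW.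
have [->|/set0Pn[s0 s0W]] := eqVneq W set0; first by [].
case: (@arg_minnP _ s0 (fun s => s \in W) (fun s : {set V} => #|s|) s0W) => s sW smin.
have [v vs vA] := HW s sW.
have col := collapse_poset_vertex dA sW smin vs vA.
rewrite (collapse_acyclic rk_sum_inj n col); apply: IH.
  by move: cW; rewrite (cardsD1 s W) sW.
by move=> t; rewrite inE => /andP[_ /HW].
Qed.

Lemma down_closedD1 A a : down_closed A ->
  (forall b, b \in A -> #|b| <= #|a|)%N -> down_closed (A :\ a).
Proof.
move=> dA amax s t; rewrite !inE => /andP[sa sA] ts; rewrite (dA _ _ sA ts) andbT.
by apply: contra sa => /eqP ta; rewrite eq_sym eqEcard -{1}ta ts amax.
Qed.

(** The faces to be removed have simplex part exactly [a]. Every member of their chains contains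
    [a], so [a], viewed as an element of [W], can be toggled at the bottom of the chain. *)
Lemma collapse_simplex A W a : down_closed A -> a \in A -> a \in W ->
  (forall b, b \in A -> #|b| <= #|a|)%N ->
  collapse (inr a) (cylinder A W) (cylinder (A :\ a) W).
Proof.
move=> dA aA aW amax; split; first exact: cylinder_down.
- exact/cylinder_down/down_closedD1.
- by apply: cylinderS => //; apply: subsetDl.
move=> B /cylinderP[BA BW BS] BN.
have aB : inl @^-1: B = a.
  by apply/eqP; apply: contraNT BN => aB; apply/cylinderP; rewrite in_setD1 aB.
split; last by apply/negP => /cylinderP[]; rewrite inl_delr aB in_setD1 eqxx.
apply/cylinderP; rewrite inl_addr inr_addr aB; rewrite aB in BS; split=> //; last first.
  by move=> s /setU1P[->|/BS].
move: BW; rewrite !order_complexE subUset sub1set aW => /andP[-> /chainP Bch] /=.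
apply/chainP => s t /setU1P[->|sB] /setU1P[->|tB]; rewrite ?subxx ?BS ?orbT //.
exact: Bch.
Qed.

(** The nonempty simplices of [A] are removed one by one, largest first, which leaves the order
    complex of [W]. *)
Lemma cylinder_top A W n : down_closed A -> set0 \in A ->
  (forall a, a \in A -> a != set0 -> a \in W) ->
  acyclic_at rk_sum (cylinder A W) n <-> acyclic_at rk_sum (cylinder [set set0] W) n.
Proof.
have [N] := ubnP #|A|; elim: N A => // N IH A cA dA A0 AW.
have [E|] := eqVneq (A :\ set0) set0.
  by rewrite -(setD1K A0) E setU0.
case/set0Pn=> a0; rewrite !inE => /andP[a0N a0A].
case: (@arg_maxnP _ a0 (fun a => a \in A) (fun s : {set V} => #|s|) a0A) => a aA amax.
have aN : a != set0.
  by rewrite -card_gt0; apply: leq_trans (amax _ a0A); rewrite card_gt0.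
have col := collapse_simplex dA aA (AW _ aA aN) amax.
rewrite (collapse_acyclic rk_sum_inj n col); apply: IH.
- by move: cA; rewrite (cardsD1 a A) aA.
- exact: down_closedD1.
- by rewrite !inE eq_sym aN.
by move=> b; rewrite !inE => /andP[_ /AW].
Qed.

Lemma cylinder_set0 A : cylinder A set0 = [set inl @: (s : {set V}) | s : {set V} in A].
Proof.
apply/setP => B; apply/cylinderP/imsetP => [[BA]|[s sA ->]].
  rewrite order_complexE subset0 => /andP[/eqP B0 _] _; exists (inl @^-1: B) => //.
  apply/setP => -[v|s].
    by rewrite mem_imset ?inE // => ? ? [].
  apply/idP/imsetP => [sB|[]//].
  by have : s \in inr @^-1: B; [rewrite inE | rewrite B0 inE].
have E0 : inr @^-1: (inl @: s) = set0 :> {set {set V}}.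
  by apply/setP => t; rewrite !inE; apply/imsetP => -[].
rewrite E0 preimset_imset; last by move=> ? ? [].
split=> // [|t]; last by rewrite inE.
by rewrite order_complexE sub0set; apply/chainP => ? ?; rewrite inE.
Qed.

Lemma cylinder_set1 W :
  cylinder [set set0] W = [set inr @: (S : {set {set V}}) | S : {set {set V}} in order_complex W].
Proof.
apply/setP => B; apply/cylinderP/imsetP => [[/set1P B0 BW _]|[S SW ->]].
  exists (inr @^-1: B) => //; apply/setP => -[v|s]; last first.
    by rewrite mem_imset ?inE // => ? ? [].
  apply/idP/imsetP => [vB|[]//].
  by have : v \in inl @^-1: B; [rewrite inE | rewrite B0 inE].
have E0 : inl @^-1: (inr @: S) = set0 :> {set V}.
  by apply/setP => t; rewrite !inE; apply/imsetP => -[].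
rewrite E0 preimset_imset; last by move=> ? ? [].
by split=> // [|t _]; rewrite ?inE // sub0set.
Qed.

Lemma acyclic_order_complex C G n : down_closed C -> set0 \in C ->
  acyclic_at (fun v : V => enum_rank v) (induced C (~: G)) n ->
  acyclic_at (fun s : {set V} => enum_rank s)
    (order_complex [set s in C | ~~ (s \subset G)]) n.
Proof.
move=> dC C0 ac; set A := induced C (~: G); set W := [set s in C | _].
have dA : down_closed A.
  move=> s t; rewrite !inE => /andP[sC sG] ts.
  by rewrite (dC _ _ sC ts) (subset_trans ts sG).
have bot : acyclic_at rk_sum (cylinder A W) n.
  apply/cylinder_bottom => // [s|].
    (* Any vertex [v] of [s] outside [G] is an apex: adding it to a face of [A] inside [s] stays
       inside [s] and avoids [G]. *)
    rewrite inE => /andP[sC /subsetPn[v vs vG]]; exists v => // a.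
    rewrite !inE => /andP[aC aG] as_; rewrite subUset sub1set inE vG aG.
    by rewrite !andbT; apply: (dC s) => //; rewrite subUset sub1set vs.
  rewrite cylinder_set0.
  by apply/(@acyclic_transport _ _ (fun v : V => enum_rank v)) => // ? ? [].
have A0 : set0 \in A by rewrite inE C0 sub0set.
have AW a : a \in A -> a != set0 -> a \in W.
  rewrite !inE => /andP[-> aG] /set0Pn[v va] /=.
  by apply/subsetPn; exists v => //; have := subsetP aG v va; rewrite inE.
have := (cylinder_top n dA A0 AW).1 bot.
rewrite cylinder_set1.
move/(@acyclic_transport _ _ (fun s : {set V} => enum_rank s)); apply.
- by move=> ? ? [].
- by move=> u v /=; rewrite ltn_add2l.
exact: order_complex_down.
Qed.
End OrderComplex.

(** * Matroid rank and flats *)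

Section MatroidRank.
Variables (V : finType) (M : {set {set V}}).
Hypothesis hM : is_matroid M.
Implicit Types (A B F G X Y s t : {set V}).

Lemma indep0 : set0 \in M.
Proof. by case/and3P: hM. Qed.

Lemma indepS A B : A \in M -> B \subset A -> B \in M.
Proof. by case/and3P: hM => _ /forall_inP H _ /H/forallP/(_ B)/implyP; apply. Qed.

Lemma indep_augment A B : A \in M -> B \in M -> (#|A| < #|B|)%N ->
  exists x, [/\ x \in B, x \notin A & x |: A \in M].
Proof.
case/and3P: hM => _ _ /forall_inP H /H/forall_inP/[apply]/implyP/[apply].
by case/exists_inP => x; rewrite inE => /andP[xA xB] xAM; exists x.
Qed.

Lemma card_indep_le_mrank A X : A \in M -> A \subset X -> (#|A| <= mrank M X)%N.
Proof.
by move=> AM AX; rewrite /mrank (bigD1 A) ?AM //=; apply: leq_maxl.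
Qed.

Lemma mrank_basis X : exists A, [/\ A \in M, A \subset X & #|A| = mrank M X].
Proof.
have P0 : (set0 \in M) && (set0 \subset X) by rewrite indep0 sub0set.
rewrite /mrank (bigmax_eq_arg set0) //.
by case: arg_maxnP => // A /andP[AM AX] _; exists A.
Qed.

Lemma mrank_leP X n :
  reflect (forall A, A \in M -> A \subset X -> (#|A| <= n)%N) (mrank M X <= n)%N.
Proof.
apply: (iffP idP) => [H A AM AX|H]; first exact: leq_trans (card_indep_le_mrank AM AX) H.
by have [A [AM AX <-]] := mrank_basis X; apply: H.
Qed.

Lemma mrankS X Y : X \subset Y -> (mrank M X <= mrank M Y)%N.
Proof.
move=> XY; apply/mrank_leP => A AM AX.
exact: card_indep_le_mrank (subset_trans AX XY).
Qed.

Definition matroid_closure X : {set V} := [set x | mrank M (x |: X) <= mrank M X]%N.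

Lemma closure_sub X : X \subset matroid_closure X.
Proof. by apply/subsetP => x xX; rewrite inE (setUidPr _) // sub1set. Qed.

Lemma mrank_closure X : mrank M (matroid_closure X) = mrank M X.
Proof.
apply/eqP; rewrite eqn_leq (mrankS (closure_sub X)) andbT leqNgt; apply/negP.
have [A [AM AX EA]] := mrank_basis X; have [B [BM BX <-]] := mrank_basis (matroid_closure X).
(* A larger independent set in the closure would extend the basis [A] of [X] by some [x] of the
   closure, raising the rank of [x |: X]. *)
rewrite -EA => /(indep_augment AM BM)[x [xB xA xAM]].
have := subsetP BX x xB; rewrite inE => /(mrank_leP _ _)/(_ _ xAM (setUS _ AX)).
by rewrite cardsU1 xA EA ltnn.
Qed.

Lemma closure_flat X : flat M (matroid_closure X).
Proof.
apply/forall_inP => x; rewrite !inE -ltnNge mrank_closure => /leq_trans; apply.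
exact/mrankS/setUS/closure_sub.
Qed.

Lemma closure_min F X : flat M F -> X \subset F -> matroid_closure X \subset F.
Proof.
move=> /forall_inP flF XF; apply/subsetP => x; rewrite inE; apply: contraTT => xF.
have {flF} := flF x; rewrite inE => /(_ xF) ltF; rewrite -ltnNge.
have [A [AM AX EA]] := mrank_basis X.
have P0 : [&& A \in M, A \subset A & A \subset F] by rewrite AM subxx (subset_trans AX).
(* Extend the basis [A] of [X] to a maximal independent [D] inside [F]. Augmenting [D] within
   [x |: F] can only add [x], so [x |: A] is independent and [x] is not in the closure of [X]. *)
have [D /and3P[DM AD DF] Dmax] := @arg_maxnP _ A
  (fun D : {set V} => [&& D \in M, A \subset D & D \subset F]) (fun D : {set V} => #|D|) P0.
have [B [BM BF EB]] := mrank_basis (x |: F).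
have DB : (#|D| < #|B|)%N by rewrite EB; apply: leq_ltn_trans ltF; apply: card_indep_le_mrank.
have [y [yB yD yDM]] := indep_augment DM BM DB.
have yx : y = x.
  have /setU1P[//|yF] := subsetP BF y yB.
  have /Dmax : [&& y |: D \in M, A \subset y |: D & y |: D \subset F].
    by rewrite yDM (subset_trans AD (subsetUr _ _)) subUset sub1set yF.
  by rewrite /= cardsU1 yD /= ltnn.
have xA : x \notin A by rewrite -yx; apply: contra yD; apply: (subsetP AD).
rewrite -EA; have := card_indep_le_mrank (indepS yDM (setUS [set y] AD)) (setUS [set y] AX).
by rewrite yx cardsU1 xA.
Qed.

Lemma flat_closure G X : flat M G -> X \subset G -> (mrank M G <= mrank M X)%N ->
  G = matroid_closure X.
Proof.
move=> flG XG rG; apply/eqP; rewrite eqEsubset closure_min // andbT.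
apply/subsetP => x xG; rewrite inE (leq_trans _ rG) // mrankS //.
by rewrite subUset sub1set xG.
Qed.

Lemma flatT : flat M setT.
Proof. by apply/forall_inP => x; rewrite !inE. Qed.

(** Since [k] is at most the rank of [M], the bases of the truncation are the independent sets of
    size [k]. *)
Lemma contains_trunc_basis k s : (k <= mrank M setT)%N ->
  [exists B, is_basis (trunc M k) B && (B \subset s)] = (k <= mrank M s)%N.
Proof.
move=> kM; apply/existsP/idP => [[B /andP[/andP[]]]|ks].
  rewrite inE => /andP[BM Bk] /forallP Bmax Bs.
  suff <- : #|B| = k by apply: card_indep_le_mrank.
  apply/eqP; rewrite eqn_leq Bk leqNgt; apply/negP => ltk.
  have [A [AM _ EA]] := mrank_basis setT.
  have [|x [_ xB xBM]] := indep_augment BM AM; first by rewrite EA (leq_trans ltk).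
  by have := Bmax x; rewrite xB inE xBM cardsU1 xB ltk.
have [A [AM As EA]] := mrank_basis s.
have [B BA EB] : exists2 B : {set V}, B \subset A & #|B| = k.
  have : (0 < #|[set B : {set V} | B \subset A & #|B| == k]|)%N.
    by rewrite cards_draws bin_gt0 EA.
  by rewrite card_gt0 => /set0Pn[B]; rewrite inE => /andP[? /eqP]; exists B.
exists B; rewrite /is_basis inE (indepS AM BA) EB leqnn (subset_trans BA As) /= andbT.
by apply/forallP => x; apply/implyP => xB; rewrite inE cardsU1 xB EB ltnn andbF.
Qed.
End MatroidRank.

(** * The induction over flats *)

Section Intersection.
Variables (V : finType) (C M : {set {set V}}) (k m : nat).
Hypotheses (dC : down_closed C) (C0 : set0 \in C) (hM : is_matroid M).
Implicit Types (F G s t : {set V}) (Gs : seq {set V}).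

Definition nonface G : {set {set V}} := [set s in C | ~~ (s \subset G)].

Hypothesis hyp : forall G n, flat M G -> (mrank M G < k)%N -> (n + mrank M G < k + m)%N ->
  acyclic_at (fun s : {set V} => enum_rank s) (order_complex (nonface G)) n.

(* For a flat [F], these are the simplices whose closure does not lie in the
   order ideal of flats of rank below [j] contained in [F]. *)
Definition avoid F j : {set {set V}} :=
  [set s in C | ~~ (s \subset F) || (j <= mrank M s)%N].

(** The stages between [avoid F j] and [avoid F j.+1], once the flats in [Gs] have been treated. *)
Definition avoid_seq F j Gs : {set {set V}} :=
  [set s in avoid F j | all (fun G : {set V} => ~~ (s \subset G)) Gs].

Lemma up_closed_nonface G : up_closed C (nonface G).
Proof.
split=> [|s t]; first by apply/subsetP => s; rewrite inE => /andP[].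
by rewrite !inE => /andP[_ sG] st ->; apply: contra sG; apply: subset_trans.
Qed.

Lemma up_closed_avoid_seq F j Gs : up_closed C (avoid_seq F j Gs).
Proof.
split=> [|s t]; first by apply/subsetP => s; rewrite !inE => /andP[/andP[]].
rewrite !inE => /andP[/andP[_ sF] /allP sGs] st -> /=; apply/andP; split.
  case/orP: sF => [sF|js]; last by rewrite (leq_trans js) ?orbT // mrankS.
  by rewrite (contra _ sF) //; apply: subset_trans.
by apply/allP => G /sGs; apply: contra; apply: subset_trans.
Qed.

Definition flats_in F j := [seq G <- enum {set V} | [&& flat M G, G \subset F & mrank M G == j]].

Lemma avoid_succ F j : flat M F -> avoid F j.+1 = avoid_seq F j (flats_in F j).
Proof.
move=> flF; apply/setP => s; rewrite !inE -andbA; case: (s \in C) => //=.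
apply/idP/andP => [sF|[]].
  split; first by case/orP: sF => [->//|/ltnW->]; rewrite orbT.
  apply/allP => G; rewrite mem_filter => /andP[/and3P[_ GF /eqP rG] _].
  case/orP: sF => [|js]; first by apply: contra => /subset_trans; apply.
  by apply: contraL js => sG; rewrite -leqNgt -rG mrankS.
case/orP => [->//|js] /allP sGs; have [sF|//] := boolP (s \subset F).
rewrite ltn_neqAle js andbT; apply/negP => /eqP rs.
(* A set of rank exactly [j] inside [F] lies in a flat of rank [j] inside [F], namely its
   closure. *)
have /sGs/negP : matroid_closure M s \in flats_in F j; last by case; apply: closure_sub.
by rewrite mem_filter closure_flat // closure_min // mrank_closure // rs eqxx mem_enum.
Qed.

Lemma avoid_seq_cons F j G Gs :
  avoid_seq F j (G :: Gs) = avoid_seq F j Gs :&: nonface G.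
Proof.
apply/setP => s; rewrite !inE /=; case: (s \in C) => //=.
by rewrite -andbA [X in _ = _ && X]andbC.
Qed.

(** A set of rank at least [j] inside [G] has closure [G], so no other flat of rank [j] contains it.
    Hence the earlier flats [Gs] do not affect the union. *)
Lemma avoid_seq_union F j G Gs : G \in flats_in F j -> {subset Gs <= flats_in F j} ->
  G \notin Gs -> avoid_seq F j Gs :|: nonface G = avoid G j.
Proof.
rewrite mem_filter => /andP[/and3P[flG GF /eqP rG] _] sub GGs.
apply/setP => s; rewrite !inE -andbA; case: (s \in C) => //=.
have [sG|sG] := boolP (s \subset G); rewrite ?orbT // orbF (subset_trans sG GF) /=.
apply/andP/idP => [[]//|js]; split=> //; apply/allP => H HGs.
have := sub H HGs; rewrite mem_filter => /andP[/and3P[flH HF /eqP rH] _].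
apply: contra GGs => sH.
by rewrite (flat_closure hM flG sG) ?rG // -(flat_closure hM flH sH) ?rH.
Qed.

Lemma acyclic_avoid j F n : (j <= k)%N -> flat M F -> (n + j <= k + m)%N ->
  acyclic_at (fun s : {set V} => enum_rank s) (order_complex (avoid F j)) n.
Proof.
elim: j F n => [|j IH] F n jk flF njk.
  have -> : avoid F 0 = C by apply/setP => s; rewrite inE orbT andbT.
  (* The empty simplex is comparable with every simplex, so it can be added to every chain. *)
  apply: (@cone_acyclic _ _ (@rk_enum_inj _) set0); first exact: order_complex_down.
  move=> S; rewrite !order_complexE subUset sub1set C0 => /andP[-> /chainP cS] /=.
  apply/chainP => s t /setU1P[->|sS] /setU1P[->|tS]; rewrite ?sub0set ?orbT //.
  exact: cS.
rewrite avoid_succ //.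
have : {subset flats_in F j <= flats_in F j} by [].
have : uniq (flats_in F j) by rewrite filter_uniq // enum_uniq.
(* The list of treated flats varies, while the occurrence left out keeps recording that they are
   flats of rank [j] in [F]. *)
elim: {1 2 4}(flats_in F j) => [|G Gs IHG] /=.
  move=> _ _; have -> : avoid_seq F j [::] = avoid F j.
    by apply/setP => s; rewrite inE andbT.
  apply: IH => //; first exact: ltnW.
  by apply: leq_trans njk; rewrite leq_add2l.
case/andP=> GGs uGs sub.
have subGs : {subset Gs <= flats_in F j}.
  by move=> H HGs; apply: sub; rewrite inE HGs orbT.
have GF : G \in flats_in F j by apply: sub; rewrite mem_head.
rewrite avoid_seq_cons -order_complexI.
have := GF; rewrite mem_filter => /andP[/and3P[flG _ /eqP rG] _].
(* The union is needed one degree higher, at [n.+1], which the bound for [j] allows because the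
   bound for [j.+1] is smaller by one. *)
apply: mayer_vietoris; try exact: order_complex_down.
- exact: rk_enum_inj.
- exact: IHG.
- by apply: hyp; rewrite // rG // -addnS.
rewrite (order_complexU (up_closed_avoid_seq F j Gs) (up_closed_nonface G)).
rewrite avoid_seq_union //; apply: IH => //; first exact: ltnW.
by rewrite addSnnS.
Qed.
End Intersection.

(** * Reduction of the theorem to the induction over flats *)

Lemma is_complex_down (T : finType) (K : {set {set T}}) : is_complex K -> down_closed K.
Proof.
by case/andP=> _ /forall_inP H s t /H/forallP/(_ t)/implyP.
Qed.

Theorem theorem5p6 (V : finType) (C M : {set {set V}}) (k m : nat)
  (hC : is_complex C) (hM : is_matroid M)
  (hk1 : (1 <= k)%N) (hk2 : (k <= mrank M setT)%N)
  (hyp : forall X : {set V},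
      flat M (~: X) -> (mrank M (~: X) <= k.-1)%N ->
      match eta (induced C X) with
      | Some a => (k + m <= a + mrank M (~: X))%N
      | None => true
      end) :
  match eta (Int C (trunc M k)) with
  | Some a => (m.+1 <= a)%N
  | None => true
  end.
Proof.
have dC := is_complex_down hC; have /andP[C0 _] := hC.
have -> : Int C (trunc M k) = order_complex (avoid C M setT k).
  (* Every simplex lies in [setT], so [avoid] keeps exactly those of rank at least [k], the ones
     containing a basis of the truncation. *)
  congr (order_complex _); apply/setP => s.
  by rewrite !inE subsetT contains_trunc_basis.
apply/eta_geP; first exact: order_complex_down.
move=> n nm; apply: (acyclic_avoid (k := k) (m := m)) => //;
  [|exact: flatT|by rewrite addnC leq_add2l].
move=> G p flG rG pG; apply: acyclic_order_complex => //.
have dG : down_closed (induced C (~: G)).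
  by move=> s t; rewrite !inE => /andP[sC sG] ts; rewrite (dC _ _ sC ts) (subset_trans ts).
have := hyp (~: G); rewrite setCK => /(_ flG).
have -> : (mrank M G <= k.-1)%N by rewrite -ltnS prednK.
(* The assumption for the complement of [G] bounds [eta] below by [k + m - mrank M G]. *)
move=> /(_ isT) H; apply: ((eta_geP (k + m - mrank M G) dG).1 _ p).
  by case: (eta _) H => // a; rewrite leq_subLR (addnC a).
by rewrite ltn_subRL (addnC _ p).
Qed.
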